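(* Let $n\ge1$, $a,b\in\mathbb{C}$ and $C(\partial)\in\mathbb{C}[\partial]^{n\times n}$. Then $V_{a,b,C(\partial)}$ is conformal if and only if $G'(\partial)+C(\partial)G(\partial)=0$ for some $G(\partial)\in\mathbb{C}[\partial]^{n\times n}$ with $\det G(\partial)\in\mathbb{C}\setminus\{0\}$.
   Context: The Virasoro conformal algebra is $Vir=\mathbb{C}[\partial]L$ with $[L_\lambda L]=(\partial+2\lambda)L$. A generalized conformal module $V$ over $Vir$ is a $\mathbb{C}[\partial]$-module with a linear map $L_\lambda:V\to V[[\lambda]]$ such that $L_\lambda(\partial v)=(\partial+\lambda)L_\lambda v$ and $L_\lambda(L_\mu v)-L_\mu(L_\lambda v)=(\lambda-\mu)L_{\lambda+\mu}v$ for all $v\in V$. It is called conformal if $L_\lambda v\in V[\lambda]$ (polynomial in $\lambda$) for every $v\in V$. For $a,b\in\mathbb{C}$ and $C(\partial)\in\mathbb{C}[\partial]^{n\times n}$, $V_{a,b,C(\partial)}$ is the free $\mathbb{C}[\partial]$-module $\mathbb{C}[\partial]^n$ with the action $$L_\lambda\mathbf{f}(\partial)=(\partial+a\lambda+b)e^{\lambda\mathcal{L}}\mathbf{f}(\partial)=\sum_{k\ge0}\frac{\lambda^k}{k!}\big((\partial+b)\mathcal{L}^k+ka\mathcal{L}^{k-1}\big)\mathbf{f}(\partial),$$ where $\mathcal{L}=\frac{d}{d\partial}+C(\partial)$ acts on column vectors by $\mathcal{L}\mathbf{f}=\mathbf{f}'+C(\partial)\mathbf{f}$. This is a generalized conformal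 module over $Vir$. $G'(\partial)$ denotes the entrywise derivative. *)

(* Defs.v *)
From HB Require Import structures.
From mathcomp Require Import all_boot all_order all_algebra.
From mathcomp Require Import reals.
From mathcomp.real_closed Require Import complex.
Set Implicit Arguments.
Unset Strict Implicit.
Unset Printing Implicit Defensive.
Import GRing.Theory.
Local Open Scope ring_scope.

(* A formal power series in V[[lambda]] (resp. V[[lambda, mu]]) is its family
   of coefficients nat -> V (resp. nat -> nat -> V, where u i j is the
   coefficient of lambda^i mu^j). *)
Section PowerSeries.
Variable V : zmodType.

Definition mul_lambda (u : nat -> V) : nat -> V :=
  fun k => if k is k'.+1 then u k' else 0.

Definition mul_lambda2 (u : nat -> nat -> V) : nat -> nat -> V :=
  fun i j => if i is i'.+1 then u i' j else 0.

Definition mul_mu2 (u : nat -> nat -> V) : nat -> nat -> V :=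
  fun i j => if j is j'.+1 then u i j' else 0.

(* u(lambda + mu), by the binomial formula *)
Definition subst_add (u : nat -> V) : nat -> nat -> V :=
  fun i j => u (i + j)%N *+ 'C(i + j, i).

Definition is_polynomial_series (u : nat -> V) : Prop :=
  exists N : nat, forall k : nat, (N <= k)%N -> u k = 0.

End PowerSeries.

(* C[d]-modules are lmodTypes over {poly F}, with d acting as 'X *: _ ;
   L v k is the coefficient of lambda^k in L_lambda v. *)
Section VirModules.
Variables (F : fieldType) (V : lmodType {poly F}).
Implicit Type L : V -> nat -> V.

Record generalized_conformal L : Prop := GeneralizedConformal {
  gconf_linear : forall (c : F) (u v : V) (k : nat),
    L (c%:P *: u + v) k = c%:P *: L u k + L v k;
  (* L_lambda (d v) = (d + lambda) L_lambda v *)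
  gconf_sesqui : forall (v : V) (k : nat),
    L ('X *: v) k = 'X *: L v k + mul_lambda (L v) k;
  (* L_lambda (L_mu v) - L_mu (L_lambda v)
       = (lambda - mu) L_(lambda + mu) v, where L_lambda acts
     coefficientwise on series in mu, and conversely *)
  gconf_bracket : forall (v : V) (i j : nat),
    L (L v j) i - L (L v i) j =
    mul_lambda2 (subst_add (L v)) i j - mul_mu2 (subst_add (L v)) i j }.

Definition conformal L : Prop :=
  generalized_conformal L /\ forall v : V, is_polynomial_series (L v).

End VirModules.

Section ModuleVabC.
Variables (F : fieldType) (n : nat).

Definition deriv_mx (m p : nat) (A : 'M[{poly F}]_(m, p)) :
  'M[{poly F}]_(m, p) := map_mx (fun q : {poly F} => q^`()) A.

Definition calL (C : 'M[{poly F}]_n) (f : 'cV[{poly F}]_n) :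
  'cV[{poly F}]_n := deriv_mx f + C *m f.

(* For k = 0 the second summand vanishes, whatever the value of 0.-1. *)
Definition V_action (a b : F) (C : 'M[{poly F}]_n) (f : 'cV[{poly F}]_n) :
  nat -> 'cV[{poly F}]_n :=
  fun k => ((k`!%:R)^-1)%:P *:
    (('X + b%:P) *: iter k (calL C) f
     + (k%:R * a)%:P *: iter k.-1 (calL C) f).

End ModuleVabC.

(* Main.v *)
(* Write D = d/dX + C, so that D (X f) = X (D f) + f.
   If G' + C G = 0 with G invertible, then D^k (G f) = G f^(k) vanishes for
   large k, hence so does the coefficient of lambda^k.
   Conversely, if (X + b) D^k v + k a D^(k-1) v = 0 for all large k, comparing D
   of one such relation with the next gives (1 - a) D^k v = 0, and for a = 1 the
   relation (X + b) D w = - k w forces w = 0 by looking at the order of w at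
   -b; so D is locally nilpotent. The Taylor sums of (- X)^k / k! D^k e_j are
   then finite, lie in the kernel of D and have value e_j at 0; let G be the
   matrix with these columns. By induction on the order of nilpotency (integrate
   D f = G h) every f lies in the image of G, so G is invertible. *)
Require Import Defs.
From HB Require Import structures.
From mathcomp Require Import all_boot all_order all_algebra.
From mathcomp Require Import ring.
From mathcomp Require Import reals.
From mathcomp.real_closed Require Import complex.
Set Implicit Arguments.
Unset Strict Implicit.
Unset Printing Implicit Defensive.
Import GRing.Theory.
Local Open Scope ring_scope.

(** * Entrywise derivatives of polynomial matrices *)

Section DerivMatrix.
Variable F : fieldType.

Lemma deriv_mxD m p (A B : 'M[{poly F}]_(m, p)) :
  deriv_mx (A + B) = deriv_mx A + deriv_mx B.
Proof. by apply/matrixP=> i j; rewrite !mxE derivD. Qed.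

Lemma deriv_mxM m p q (A : 'M[{poly F}]_(m, p)) (B : 'M[{poly F}]_(p, q)) :
  deriv_mx (A *m B) = deriv_mx A *m B + A *m deriv_mx B.
Proof.
apply/matrixP=> i j; rewrite !mxE raddf_sum -big_split /=.
by apply: eq_bigr => k _; rewrite derivM !mxE.
Qed.

Lemma deriv_mxZ m p (r : {poly F}) (A : 'M[{poly F}]_(m, p)) :
  deriv_mx (r *: A) = r^`() *: A + r *: deriv_mx A.
Proof. by apply/matrixP=> i j; rewrite !mxE derivM. Qed.

Lemma iter_deriv_mx m p k (A : 'M[{poly F}]_(m, p)) i j :
  iter k (@deriv_mx F m p) A i j = (A i j)^`(k).
Proof. by elim: k => //= k IHk; rewrite mxE IHk. Qed.

Lemma iter_deriv_mx_eq0 m p (A : 'M[{poly F}]_(m, p)) :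
  exists N, forall k, (N <= k)%N -> iter k (@deriv_mx F m p) A = 0.
Proof.
exists (\max_i \max_j size (A i j)) => k le_k.
apply/matrixP=> i j; rewrite iter_deriv_mx mxE.
apply: derivn_poly0; apply: leq_trans le_k.
by rewrite (leq_trans _ (leq_bigmax i)) // (leq_bigmax j).
Qed.

End DerivMatrix.

(** * The connection D = d/dX + C and its iterates *)

Section CalL.
Variables (F : fieldType) (n : nat) (C : 'M[{poly F}]_n).
Implicit Types (f : 'cV[{poly F}]_n) (p : {poly F}).
Local Notation D := (calL C).

Lemma calLD f g : D (f + g) = D f + D g.
Proof. by rewrite /calL deriv_mxD mulmxDr addrACA. Qed.

Lemma calLZ p f : D (p *: f) = p^`() *: f + p *: D f.
Proof. by rewrite /calL deriv_mxZ -scalemxAr scalerDr addrA. Qed.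

Lemma calLZC c f : D (c%:P *: f) = c%:P *: D f.
Proof. by rewrite calLZ derivC scale0r add0r. Qed.

Lemma calL0 : D 0 = 0.
Proof. by have := calLZC 0 0; rewrite !scale0r. Qed.

Lemma calLB f g : D (f - g) = D f - D g.
Proof. by rewrite calLD -scaleN1r -polyCN calLZC polyCN scaleN1r. Qed.

(** By Leibniz, D (G f) = (G' + C G) f + G f', so G intertwines D with d/dX. *)
Lemma calL_mul (G : 'M[{poly F}]_n) f :
  deriv_mx G + C *m G = 0 -> D (G *m f) = G *m deriv_mx f.
Proof.
move=> DG0; rewrite /calL deriv_mxM mulmxA addrAC -mulmxDl DG0.
by rewrite mul0mx add0r.
Qed.

Lemma iter_calL_mul (G : 'M[{poly F}]_n) k f :
  deriv_mx G + C *m G = 0 ->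
  iter k D (G *m f) = G *m iter k (@deriv_mx F n 1) f.
Proof. by move=> DG0; elim: k => //= k ->; rewrite calL_mul. Qed.

Lemma iter_calLD k f g : iter k D (f + g) = iter k D f + iter k D g.
Proof. by elim: k => //= k ->; rewrite calLD. Qed.

Lemma iter_calLZC k c f : iter k D (c%:P *: f) = c%:P *: iter k D f.
Proof. by elim: k => //= k ->; rewrite calLZC. Qed.

(** The commutator [D, p] = p' = 1 commutes with D, so [D^k, p] = k D^(k-1). This serves for p = X
    and p = X + b. *)
Lemma iter_calLX k p f : p^`() = 1 ->
  iter k D (p *: f) = p *: iter k D f + iter k.-1 D f *+ k.
Proof.
move=> dp; elim: k => [|k IHk]; first by rewrite addr0.
rewrite iterS IHk calLD calLZ dp scale1r.
rewrite addrAC addrC; congr (_ + _).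
case: k {IHk} => [|k] /=; first by rewrite calL0 addr0.
by rewrite -(scaler_nat k.+1) -polyC_natr calLZC polyC_natr scaler_nat -mulrS.
Qed.

End CalL.

(** * Horizontal sections and the fundamental matrix of a locally nilpotent D *)

Section HorizontalSections.
Variables (F : numFieldType) (n : nat) (C : 'M[{poly F}]_n).
Implicit Types f u w : 'cV[{poly F}]_n.
Local Notation D := (calL C).

(* A nonzero solution would vanish at c to some finite order m, and comparing
   leading coefficients at c gives m = - N. *)
Lemma calL_euler_eq0 c N w :
  ('X - c%:P) *: D w = - (w *+ N) ->
  (N = 0%N -> forall i, root (w i 0) c) -> w = 0.
Proof.
move=> Dw w0; pose p : {poly F} := 'X - c%:P.
have p_neq0 : p != 0 by rewrite polyXsubC_eq0.
have div m : exists w', w = p ^+ m *: w'.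
  elim: m => [|m [w' def_w]]; first by exists w; rewrite expr0 scale1r.
  suff w'0 i : root (w' i 0) c.
    exists (\col_i (w' i 0 %/ p)); rewrite def_w exprSr -scalerA; congr (_ *: _).
    apply/colP=> i; rewrite !mxE mulrC divpK //.
    by rewrite /p dvdp_XsubCl.
  have [/eqP m0|mN_neq0] := boolP (m + N == 0)%N.
    move/eqP: m0; rewrite addn_eq0 => /andP[/eqP m0 /eqP N0].
    by have:= w0 N0 i; rewrite def_w m0 expr0 scale1r.
  have dp : p^`() = 1 by rewrite derivB derivX derivC subr0.
  (* Substitute w = p^m w'. Cancelling p^m and evaluating at c leaves (m + N) w'(c) = 0, and m + N
     is nonzero in characteristic 0. *)
  have /eqP : p ^+ m *: (p *: D w' + w' *+ (m + N)) = 0.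
    move/eqP: Dw; rewrite def_w -addr_eq0 calLZ deriv_exp dp mul1r => /eqP <-.
    rewrite -/p; move: (D w') => W; clear; case: m => [|m] /=;
      by apply/matrixP=> r s; rewrite !(mulmxnE, mxE) ?exprS; ring.
  rewrite scalemx_eq0 expf_eq0 (negPf p_neq0) andbF /= => /eqP/colP/(_ i).
  rewrite !mxE mulmxnE => /(congr1 (horner^~ c)).
  rewrite hornerD hornerM hornerXsubC subrr mul0r add0r hornerMn horner0.
  by move/eqP; rewrite Num.Theory.mulrn_eq0 (negPf mN_neq0).
(* A nonzero entry is not divisible by a power of p of degree larger than its own. *)
apply/colP=> i; rewrite mxE; apply/eqP/negPn/negP => wi_neq0.
have [w' def_w] := div (size (w i 0)).
have /(dvdp_leq wi_neq0) : p ^+ size (w i 0) %| w i 0.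
  by rewrite [X in _ %| X](congr1 (fun A : 'cV_n => A i 0) def_w) mxE dvdp_mulIl.
by rewrite size_exp_XsubC ltnn.
Qed.

Lemma calL_uniq u c : D u = 0 -> (forall i, root (u i 0) c) -> u = 0.
Proof.
by move=> Du0 u0; apply: (@calL_euler_eq0 c 0) => //; rewrite Du0 scaler0 oppr0.
Qed.

(** Truncation of exp(- X D), with the powers of X placed to the left of those of D. *)
Definition taylor0 N f : 'cV[{poly F}]_n :=
  \sum_(k < N) ((k`!%:R)^-1)%:P *: ((- 'X) ^+ k *: iter k D f).

(** The sum telescopes: differentiating (- X)^k / k! cancels what D makes of the preceding term, so
    only the last contribution survives. *)
Lemma calL_taylor0 N f :
  D (taylor0 N.+1 f) = ((N`!%:R)^-1)%:P *: ((- 'X) ^+ N *: iter N.+1 D f).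
Proof.
elim: N => [|N IHN].
  by rewrite /taylor0 big_ord1 /= expr0 fact0 invr1 !scale1r.
rewrite /taylor0 big_ord_recr /= calLD -/(taylor0 _ _) IHN calLZC calLZ.
rewrite deriv_exp derivN derivX iterS;
  move: (D (iter N D f)) (D (D _)) => W1 W2.
have -> : (N`!%:R^-1)%:P = (N.+1`!%:R^-1)%:P * N.+1%:R :> {poly F}.
  rewrite -polyC_natr -polyCM factS natrM invfM mulrAC mulVf ?mul1r //.
  by rewrite Num.Theory.pnatr_eq0.
by apply/matrixP=> r s; rewrite !mxE !exprS; ring.
Qed.

Lemma taylor0_at0 N f i : (0 < N)%N -> (taylor0 N f i 0).[0] = (f i 0).[0].
Proof.
case: N => // N _; rewrite /taylor0 big_ord_recl /= fact0 invr1 expr0 !scale1r.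
rewrite mxE hornerD summxE horner_sum big1 ?addr0 // => k _.
by rewrite !mxE !hornerM horner_exp hornerN hornerX oppr0 exprS !mul0r mulr0.
Qed.

Lemma exists_deriv_mx m p (A : 'M[{poly F}]_(m, p)) :
  exists B, deriv_mx B = A.
Proof.
(* The constant term is a division by 0, hence 0. *)
exists (\matrix_(i, j)
  \poly_(k < (size (A i j)).+1) ((A i j)`_k.-1 / k%:R)).
apply/matrixP=> i j; rewrite !mxE; apply/polyP=> k.
rewrite coef_deriv coef_poly ltnS /=; case: ltnP => [_|le_k].
  by rewrite -[LHS]mulr_natr divfK // Num.Theory.pnatr_eq0.
by rewrite mul0rn nth_default.
Qed.

Lemma nilpotent_fundamental_matrix :
  (forall f, exists N, iter N D f = 0) ->
  exists G : 'M[{poly F}]_n,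
    (exists2 c : F, c != 0 & \det G = c%:P) /\ deriv_mx G + C *m G = 0.
Proof.
move=> nilD.
have /fin_all_exists2[u Du u0] (j : 'I_n) : exists2 u, D u = 0 &
    forall i, (u i 0).[0] = (i == j)%:R.
  have [N DN0] := nilD (delta_mx j 0); exists (taylor0 N.+1 (delta_mx j 0)).
    by rewrite calL_taylor0 iterS DN0 calL0 !scaler0.
  by move=> i; rewrite taylor0_at0 // mxE andbT hornerMn hornerC.
pose G := \matrix_(i, j) u j i 0.
have DG : deriv_mx G + C *m G = 0.
  apply/matrixP=> i j; have /colP/(_ i) := Du j.
  rewrite !mxE; apply: etrans; congr (_ + _).
  by apply: eq_bigr => k _; rewrite mxE.
have kerD f : D f = 0 -> exists h, f = G *m h.
  (* Since G is the identity at 0, f and G f(0) are two horizontal sections with the same value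
     there. *)
  move=> Df; exists (\col_i ((f i 0).[0])%:P); apply/eqP; rewrite -subr_eq0.
  apply/eqP/(@calL_uniq _ 0).
    rewrite calLB Df calL_mul // sub0r.
    apply/eqP; rewrite oppr_eq0; apply/eqP.
    rewrite [X in G *m X](_ : _ = 0) ?mulmx0 //.
    by apply/colP=> i; rewrite !mxE derivC.
  move=> i; rewrite rootE !mxE hornerD hornerN horner_sum.
  rewrite (bigD1 i) //= big1 => [|j /negPf ji].
    by rewrite !mxE hornerM u0 eqxx hornerC mul1r addr0 subrr.
  by rewrite !mxE hornerM u0 eq_sym ji mul0r.
have imG f : exists h, f = G *m h.
  have [N] := nilD f; elim: N f => [|N IHN] f.
    by move=> /= ->; exists 0; rewrite mulmx0.
  (* If D f = G h and H' = h, then f - G H is horizontal, hence itself in the image of G. *)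
  rewrite iterSr => /IHN[h Df]; have [H dH] := exists_deriv_mx h.
  have /kerD[g fg] : D (f - G *m H) = 0 by rewrite calLB calL_mul // dH Df subrr.
  by exists (g + H); rewrite mulmxDr -fg subrK.
have [h Gh] := fin_all_exists (fun j : 'I_n => imG (delta_mx j 0)).
have GH : G *m (\matrix_(i, j) h j i 0) = 1%:M.
  apply/matrixP=> i j; have /colP/(_ i) := Gh j; rewrite !mxE andbT => ->.
  by apply: eq_bigr => k _; rewrite !mxE.
exists G; split=> //.
have := congr1 determinant GH; rewrite det_mulmx det1 => detG.
have : \det G \is a GRing.unit.
  by apply/unitrPr; exists (\det (\matrix_(i, j) h j i 0)).
rewrite poly_unitE => /andP[/size_poly1P[c c0 ->] _]; by exists c.
Qed.

End HorizontalSections.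

(** * The action on V_{a,b,C}: module axioms and conformality *)

Section Action.
Variables (F : numFieldType) (n : nat) (a b : F) (C : 'M[{poly F}]_n).
Implicit Types f v : 'cV[{poly F}]_n.
Local Notation D := (calL C).

(** This is k! times the coefficient of lambda^k, which keeps inverse factorials out of the
    identities below. *)
Definition action0 k f : 'cV[{poly F}]_n :=
  ('X + b%:P) *: iter k D f + (k%:R * a)%:P *: iter k.-1 D f.

Lemma V_actionE f k : V_action a b C f k = ((k`!%:R)^-1)%:P *: action0 k f.
Proof. by []. Qed.

Lemma action0D k f g : action0 k (f + g) = action0 k f + action0 k g.
Proof. by rewrite /action0 !iter_calLD !scalerDr addrACA. Qed.

Lemma action0ZC k c f : action0 k (c%:P *: f) = c%:P *: action0 k f.
Proof.
by rewrite /action0 !iter_calLZC scalerDr !scalerA ![c%:P * _]mulrC.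
Qed.

Lemma iter_action0 k j v :
  iter k D (action0 j v) =
  ('X + b%:P) *: iter (k + j) D v + k%:R *: iter (k.-1 + j) D v
  + (j%:R * a)%:P *: iter (k + j.-1) D v.
Proof.
have dXb : ('X + b%:P)^`() = 1 :> {poly F}.
  by rewrite derivD derivX derivC addr0.
by rewrite iter_calLD (iter_calLX _ _ _ dXb) iter_calLZC -!iterD scaler_nat.
Qed.

Lemma action0_X k v :
  action0 k ('X *: v) = 'X *: action0 k v + k%:R *: action0 k.-1 v.
Proof.
rewrite /action0 !(iter_calLX _ _ _ (derivX F)) !polyCM !polyC_natr.
rewrite -!scaler_nat.
case: k => [|[|k]] /=; do ?[move: (iter _ _ _) => ?].
all: by apply/matrixP=> r s; rewrite !mxE; ring.
Qed.

(** Normal form with X + b to the left of D. Wherever a predecessor is truncated at 0, its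
    coefficient vanishes. *)
Lemma action0_comp i j v :
  action0 i (action0 j v) =
  ('X + b%:P) ^+ 2 *: iter (i + j) D v
  + (('X + b%:P) * (i%:R + (i + j)%:R * a%:P)) *: iter (i + j).-1 D v
  + (i%:R * (i%:R - 1) * a%:P + i%:R * j%:R * a%:P ^+ 2)
      *: iter (i + j).-2 D v.
Proof.
rewrite {1}/action0 !iter_action0 !polyCM !polyC_natr.
case: i => [|[|i]]; case: j => [|j];
  rewrite ?addn0 ?add0n ?addSn ?addnS /=.
all: do ?[move: (iter _ _ _) => ?].
all: by apply/matrixP=> r s; rewrite !mxE; ring.
Qed.

(** The terms symmetric in i and j cancel, and i (i - 1) - j (j - 1) = (i - j) (i + j - 1) gives the
    rest. *)
Lemma action0_bracket i j v :
  action0 i (action0 j v) - action0 j (action0 i v) =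
  (i%:R - j%:R) *: action0 (i + j).-1 v.
Proof.
rewrite !action0_comp [(j + i)%N]addnC /action0 !polyCM !polyC_natr.
case: i => [|i]; case: j => [|j]; rewrite ?addn0 ?add0n ?addSn ?addnS /=.
all: do ?[move: (iter _ _ _) => ?].
all: by apply/matrixP=> r s; rewrite !mxE; ring.
Qed.

Lemma natr_fact_neq0 k : (k`!%:R : F) != 0.
Proof. by rewrite Num.Theory.pnatr_eq0 -lt0n fact_gt0. Qed.

Lemma subst_add_V_action v i j :
  subst_add (V_action a b C v) i j =
  ((i`!%:R)^-1 * (j`!%:R)^-1)%:P *: action0 (i + j) v.
Proof.
rewrite /subst_add V_actionE -scaler_nat scalerA -polyC_natr -polyCM;
  congr (_%:P *: _).
rewrite -(bin_fact (leq_addr j i)) addKn !natrM.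
have bin_neq0 : ('C(i + j, i)%:R : F) != 0.
  by rewrite Num.Theory.pnatr_eq0 -lt0n bin_gt0 leq_addr.
by field; rewrite bin_neq0 !natr_fact_neq0.
Qed.

Lemma V_action_generalized_conformal : generalized_conformal (V_action a b C).
Proof.
have factS k : (k.+1`!%:R)^-1 * k.+1%:R = (k`!%:R)^-1 :> F.
  rewrite factS natrM invfM mulrAC mulVf ?mul1r //.
  by rewrite Num.Theory.pnatr_eq0.
split=> [c u v k|v k|v i j].
- by rewrite !V_actionE action0D action0ZC scalerDr !scalerA mulrC.
- rewrite !V_actionE /mul_lambda.
  rewrite action0_X scalerDr !scalerA [_ * 'X]mulrC; congr (_ + _).
  case: k => [|k]; first by rewrite mulr0 scale0r.
  by rewrite V_actionE -polyC_natr -polyCM factS.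
- have comp x y : V_action a b C (V_action a b C v x) y =
      ((y`!%:R)^-1 * (x`!%:R)^-1)%:P *: action0 y (action0 x v).
    by rewrite !V_actionE action0ZC scalerA -polyCM.
  rewrite !comp [_^-1 * i`!%:R^-1]mulrC -scalerBr action0_bracket.
  rewrite scalerA mulrBr scalerBl; congr (_ - _).
  (* Multiplication by lambda shifts i, matching i / i! = 1 / (i - 1)!; likewise for mu and j. *)
  + case: i => [|i]; first by rewrite mulr0 scale0r.
    by rewrite /= subst_add_V_action -polyC_natr -polyCM mulrAC factS.
  + case: j => [|j]; first by rewrite mulr0 scale0r.
    by rewrite /= subst_add_V_action -polyC_natr -polyCM addnS -mulrA factS.
Qed.

Lemma conformal_nilpotent : conformal (V_action a b C) ->
  forall v, exists N, iter N D v = 0.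
Proof.
case=> _ polyV v; have [N LN0] := polyV v.
have act0 k : (N <= k)%N -> action0 k v = 0.
  move/LN0/eqP; rewrite V_actionE scalemx_eq0 polyC_eq0 invr_eq0.
  by rewrite (negPf (natr_fact_neq0 k)) => /eqP.
(* The relations of orders N + 1 and N + 2 involve only w, D w and D^2 w. *)
exists N.+1; set w := iter N D v.
have := act0 N.+1 (leqnSn N); have := act0 N.+2 (leqW (leqnSn N)).
rewrite /action0 !iterS /= -/w => E2 E1.
have dXb : ('X + b%:P)^`() = 1 :> {poly F}.
  by rewrite derivD derivX derivC addr0.
have := congr1 D E1; rewrite calLD calLZ calLZC dXb scale1r calL0.
have [a1 _|a_neq1] := eqVneq a 1.
  (* For a = 1 the first relation reads (X + b) D w = - (N + 1) w. *)
  rewrite (@calL_euler_eq0 _ _ C (- b) N.+1 w) ?calL0 //.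
  apply/eqP; rewrite -addr_eq0 polyCN opprK -E1 a1 mulr1.
  by rewrite polyC_natr scaler_nat.
move=> E3; apply/eqP.
have /eqP : (1 - a)%:P *: D w = 0.
  rewrite -[RHS](subrr 0) -{1}E3 -E2 !polyCM !polyC_natr polyCB.
  by move: (D (D w)) (D w) => W2 W1; apply/matrixP=> r s; rewrite !mxE; ring.
by rewrite scalemx_eq0 polyC_eq0 subr_eq0 eq_sym (negPf a_neq1).
Qed.

Lemma fundamental_matrix_conformal (G : 'M[{poly F}]_n) :
  G \in unitmx -> deriv_mx G + C *m G = 0 -> conformal (V_action a b C).
Proof.
move=> Gunit DG; split=> [|v]; first exact: V_action_generalized_conformal.
have [N dN0] := iter_deriv_mx_eq0 (invmx G *m v).
have DN0 k : (N <= k)%N -> iter k D v = 0.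
  by move=> /dN0 d0; rewrite -(mulKVmx Gunit v) iter_calL_mul // d0 mulmx0.
(* One more than N, because the coefficient of lambda^k also involves D^(k-1). *)
exists N.+1 => -[//|k] lt_Nk.
by rewrite /V_action !DN0 ?scaler0 ?addr0 ?scaler0 // ltnW.
Qed.

End Action.

Theorem proposition4p19 (R : realType) (n : nat) (hn : (1 <= n)%N)
    (a b : R[i]) (C : 'M[{poly R[i]}]_n) :
  conformal (V_action a b C) <->
  exists G : 'M[{poly R[i]}]_n,
    (exists2 c : R[i], c != 0 & \det G = c%:P) /\
    deriv_mx G + C *m G = 0.
Proof.
split=> [/conformal_nilpotent/nilpotent_fundamental_matrix //|].
case=> G [[c c_neq0 detG] DG]; apply: fundamental_matrix_conformal DG.
by rewrite unitmxE detG poly_unitE size_polyC c_neq0 coefC unitfE.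
Qed.
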